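(* Let $\lambda=(\lambda_1,\dots,\lambda_l)\vdash n$, $a\in\{1,2,\dots,l+1\}$, and $\mu=\lambda+\vec e_r$ with $1\le r\le a$. Then $$\mathrm{R2R}_{n+1}\circ\operatorname{projlift}^{\lambda,\mu}_a-\operatorname{projlift}^{\lambda,\mu}_a\circ\mathrm{R2R}_n=\big((n+1)+(\lambda_r+1)-r\big)\operatorname{projlift}^{\lambda,\mu}_a.$$ In particular, if $v\in S^\lambda$ is an eigenvector of $\mathrm{R2R}_n$ with eigenvalue $\varepsilon$, then either $\operatorname{projlift}^{\lambda,\mu}_a(v)=0$ or $\operatorname{projlift}^{\lambda,\mu}_a(v)$ is an eigenvector of $\mathrm{R2R}_{n+1}$ with eigenvalue $\varepsilon+(n+1)+(\lambda_r+1)-r$.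
   Context: Words are over $\{1,\dots,N\}$ ($N$ large); $M^\alpha$ is the space with basis words of evaluation $\alpha$; $\mathfrak S_m$ acts on the right on words of length $m$ by $w\cdot\sigma=w_{\sigma(1)}\cdots w_{\sigma(m)}$. $\lambda_{l+1}=0$; $\lambda+\vec e_i$ adds $1$ to the $i$-th entry; $\mu=\lambda+\vec e_r$ is understood to be a partition. $\operatorname{sh}_a(w)=\sum_{j=0}^n w_1\cdots w_j\,a\,w_{j+1}\cdots w_n$; $\mathrm{R2R}_m$ is the right action of $\xi_m=m\cdot\mathbf1+\sum_{1\le u<v\le m}(u,u+1,\dots,v)+\sum_{1\le v<u\le m}(u,u-1,\dots,v)$ (equivalently, sum over all ways of removing a letter and reinserting it). Specht module $S^\lambda\subseteq M^\lambda$: span of $\mathbf w_t=\sum_{\sigma\in\operatorname{ColStab}(t)}\operatorname{sign}(\sigma)\operatorname{word}(\sigma(t))$ for standard tableaux $t$ of shape $\lambda$, where $\operatorname{word}(t)$ has $k$-th letter the row index of $k$ in $t$. For $\mu\vdash m$ with irreducible character $\chi^\mu$ of dimension $f^\mu$, $\operatorname{isoproj}_\mu(v)=v\cdot\frac{f^\mu}{m!}\sum_{g\in\mathfrak S_m}\chi^\mu(g)g$. $\operatorname{projlift}^{\lambda,\mu}_a=(\operatorname{isoproj}_\mu\circ\operatorname{sh}_a)|_{S^\lambda}:S^\lambda\to M^{\lambda+\vec e_a}$. *)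

(* Defs.v *)
From HB Require Import structures.
From mathcomp Require Import all_boot all_order all_fingroup all_algebra.

Set Implicit Arguments.
Unset Strict Implicit.
Unset Printing Implicit Defensive.

Import GRing.Theory.
Local Open Scope ring_scope.

(* Letters, rows, columns, entries of tableaux and positions in
   words are numbered from 0: the letter i of {1, ..., N} is the ordinal of
   value i - 1 in 'I_N. *)

Definition is_partition (n : nat) (s : seq nat) : bool :=
  [&& sorted geq s, 0%N \notin s & sumn s == n].

Definition word (N m : nat) := m.-tuple 'I_N.

Section Words.

Variables (F : fieldType) (N : nat).

(* The coefficients are in F^o, the field seen as a vector space over itself,
   so that wspace m inherits the structure of a vectType. *)
Definition wspace (m : nat) := {ffun word N m -> F^o}.

Definition bword (m : nat) (w : word N m) : wspace m :=
  [ffun w' => (w' == w)%:R].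

Definition lin_ext (m : nat) (V : lmodType F) (f : word N m -> V)
    (v : wspace m) : V := \sum_(w : word N m) (v w : F) *: f w.

Definition has_eval (m : nat) (alpha : seq nat) (w : word N m) : bool :=
  [forall i : 'I_N, count_mem i w == nth 0%N alpha i].

Definition Mspace (m : nat) (alpha : seq nat) : {vspace wspace m} :=
  <<[seq bword w | w in has_eval (m := m) alpha]>>%VS.

Definition word_act (m : nat) (w : word N m) (s : 'S_m) : word N m :=
  [tuple tnth w (s k) | k < m].

Definition act (m : nat) (v : wspace m) (s : 'S_m) : wspace m :=
  lin_ext (fun w => bword (word_act w s)) v.

(* x : {ffun 'S_m -> F} stands for the element \sum_g (x g) g of the group
   algebra of 'S_m. *)
Definition alg_act (m : nat) (v : wspace m) (x : {ffun 'S_m -> F}) : wspace m :=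
  \sum_(g : 'S_m) x g *: act v g.

Definition alg_perm (m : nat) (s : 'S_m) : {ffun 'S_m -> F} :=
  [ffun g => (g == s)%:R].

(* The cycle sending each item of c to the next one, and the last item to the
   first one; undup only ensures well-definedness, and is the identity on the
   duplicate-free sequences used below. *)
Definition cycle_perm (m : nat) (c : seq 'I_m) : 'S_m :=
  perm (can_inj (prev_next (undup_uniq c))).

(* The cycles (u, u+1, ..., v) for u <= v and (u, u-1, ..., v) for v <= u. *)
Definition cycle_up (m : nat) (u v : 'I_m) : 'S_m :=
  cycle_perm [seq k : 'I_m <- enum 'I_m | (u <= k <= v)%N].

Definition cycle_down (m : nat) (u v : 'I_m) : 'S_m :=
  cycle_perm (rev [seq k : 'I_m <- enum 'I_m | (v <= k <= u)%N]).

Definition xi (m : nat) : {ffun 'S_m -> F} :=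
  alg_perm 1%g *+ m
  + \sum_(p : 'I_m * 'I_m | (p.1 < p.2)%N) alg_perm (cycle_up p.1 p.2)
  + \sum_(p : 'I_m * 'I_m | (p.2 < p.1)%N) alg_perm (cycle_down p.1 p.2).

Definition R2R (m : nat) (v : wspace m) : wspace m := alg_act v (xi m).

(* The word w_1 ... w_j a w_(j+1) ... w_n; see insert_wordE. *)
Definition insert_word (n : nat) (a : 'I_N) (j : 'I_n.+1) (w : word N n) :
    word N n.+1 :=
  [tuple if unlift j k is Some k' then tnth w k' else a | k < n.+1].

Definition sh (n : nat) (a : 'I_N) (v : wspace n) : wspace n.+1 :=
  lin_ext (fun w => \sum_(j < n.+1) bword (insert_word a j w)) v.

(* A tableau with entries 'I_n is encoded by the function mapping each entry to
   its cell (row, column); a partition of n has all its columns numbered below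
   n. *)
Definition filling (n : nat) := {ffun 'I_n -> 'I_N * 'I_n}.

Definition is_tableau (n : nat) (la : seq nat) (t : filling n) : bool :=
  injectiveb t &&
  [forall c : 'I_N * 'I_n, (c \in codom t) == (c.2 < nth 0%N la c.1)%N].

Definition is_standard (n : nat) (la : seq nat) (t : filling n) : bool :=
  is_tableau la t &&
  [forall j : 'I_n, forall k : 'I_n,
    (((t j).1 == (t k).1) && ((t j).2 < (t k).2)%N ==> (j < k)%N) &&
    (((t j).2 == (t k).2) && ((t j).1 < (t k).1)%N ==> (j < k)%N)].

Definition row_word (n : nat) (t : filling n) : word N n :=
  [tuple (t k).1 | k < n].

Definition col_stab (n : nat) (t : filling n) : {set 'S_n} :=
  [set s : 'S_n | [forall k, (t (s k)).2 == (t k).2]].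

(* The tableau s(t) has entry s k in the cell where t has entry k. *)
Definition tab_perm (n : nat) (s : 'S_n) (t : filling n) : filling n :=
  [ffun k => t ((s^-1)%g k)].

Definition specht_vec (n : nat) (t : filling n) : wspace n :=
  \sum_(s in col_stab t) (-1) ^+ odd_perm s *: bword (row_word (tab_perm s t)).

Definition specht (n : nat) (la : seq nat) : {vspace wspace n} :=
  <<[seq specht_vec t | t in is_standard (n := n) la]>>%VS.

(* The irreducible character indexed by mu is the character of the Specht
   module, i.e. the trace of the action of g, computed here in the basis vbasis
   of that module. *)
Definition specht_char (m : nat) (mu : seq nat) (g : 'S_m) : F :=
  let b := vbasis (specht m mu) in
  \sum_(i < \dim (specht m mu)) coord b i (act b`_i g).

Definition isoproj (m : nat) (mu : seq nat) (v : wspace m) : wspace m :=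
  alg_act v [ffun g : 'S_m =>
    (\dim (specht m mu))%:R / (m`!)%:R * specht_char mu g].

(* projlift is to be applied to elements of the Specht module of a partition
   la of n only; it then takes its values in Mspace n.+1 (incr_nth la a), see
   projlift_Mspace. *)
Definition projlift (n : nat) (mu : seq nat) (a : 'I_N) (v : wspace n) :
    wspace n.+1 := isoproj mu (sh a v).

Definition eigenvector (V : lmodType F) (f : V -> V) (eps : F) (v : V) : Prop :=
  v != 0 /\ f v = eps *: v.

Lemma insert_wordE n (a : 'I_N) (j : 'I_n.+1) (w : word N n) :
  insert_word a j w = take j w ++ a :: drop j w :> seq 'I_N.
Proof.
have lejn : (j <= n)%N by rewrite -ltnS.
have sz : size (take j w) = j by rewrite size_takel // size_tuple.
apply: (@eq_from_nth _ a) => [|k].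
  by rewrite size_tuple size_cat /= sz size_drop size_tuple addnS subnKC.
rewrite size_tuple => ltk.
rewrite -[k]/(val (Ordinal ltk)) -tnth_nth tnth_mktuple nth_cat sz /=.
case: unliftP => [k' eqk|eqk].
  have -> : k = bump j k' by have /= := congr1 val eqk.
  rewrite /bump (tnth_nth a); case: (leqP j k') => [lejk|ltkj].
    by rewrite add1n ltnNge leqW //= subSn //= nth_drop subnKC.
  by rewrite add0n ltkj nth_take.
have -> : k = j by have /= := congr1 val eqk.
by rewrite ltnn subnn.
Qed.

Lemma mem_Mspace m alpha (w : word N m) :
  has_eval alpha w -> bword w \in Mspace m alpha.
Proof. by move=> w_al; apply/memv_span/image_f. Qed.

Lemma lin_ext_Mspace m m' alpha (U : {vspace wspace m'}) f v :
    (forall w : word N m, has_eval alpha w -> f w \in U) ->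
  v \in Mspace m alpha -> lin_ext f v \in U.
Proof.
move=> fU v_al; apply: memv_suml => w _.
have [/fU fw|w_al] := boolP (has_eval alpha w); first exact: memvZ.
suff -> : v w = 0 by rewrite scale0r mem0v.
rewrite (coord_span v_al) sum_ffunE big1 // => i _.
rewrite ffunE.
have : (nth 0 [seq bword w0 | w0 in has_eval (m := m) alpha] i)
    \in [seq bword w0 | w0 in has_eval (m := m) alpha].
  by rewrite mem_nth ?size_image.
move=> /imageP[w' w'_al ->]; rewrite ffunE.
case: eqP w'_al => [<- w_in|_ _]; first by case/negP: w_al.
by rewrite scaler0.
Qed.

Lemma act_Mspace m alpha (v : wspace m) s :
  v \in Mspace m alpha -> act v s \in Mspace m alpha.
Proof.
apply: lin_ext_Mspace => w /forallP w_al; apply/mem_Mspace/forallP => i.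
rewrite -(eqP (w_al i)); apply/eqP/seq.permP.
by apply/tuple_permP; exists s.
Qed.

Lemma sh_Mspace n alpha (a : 'I_N) (v : wspace n) :
  v \in Mspace n alpha -> sh a v \in Mspace n.+1 (incr_nth alpha a).
Proof.
apply: lin_ext_Mspace => w /forallP w_al; apply: memv_suml => j _.
apply/mem_Mspace/forallP => i; rewrite insert_wordE nth_incr_nth count_cat /=.
by rewrite addnCA -count_cat cat_take_drop (eqP (w_al i)).
Qed.

Lemma specht_Mspace n la (v : wspace n) :
  is_partition n la -> v \in specht n la -> v \in Mspace n la.
Proof.
case/and3P=> _ _ /eqP la_n; apply: subvP; apply/span_subvP.
move=> _ /imageP[t t_la ->].
apply: memv_suml => s _; apply/memvZ/mem_Mspace/forallP => i.
have /andP[/andP[/injectiveP t_inj /forallP t_im] _] := t_la.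
have le_la : (nth 0%N la i <= n)%N.
  rewrite -la_n; elim: (la) (nat_of_ord i) => [|x la' IH] [|k] //=.
    by rewrite leq_addr.
  exact: leq_trans (IH k) (leq_addl _ _).
apply/eqP; rewrite count_map -sum1_count big_enum_cond /=.
rewrite (reindex_inj (@perm_inj _ s)) /=.
under eq_bigl => k do rewrite ffunE permK.
rewrite sum1_card -(card_imset _ t_inj) -[RHS]card_ord.
rewrite -(card_imset _ (f := fun k : 'I_(nth 0%N la i) =>
  (i, widen_ord le_la k))); last by move=> x y [] /val_inj.
apply: eq_card => c; apply/imsetP/imsetP => [[k]|[k _ ->]].
  move=> /eqP/val_inj ki ->; have := t_im (t k).
  rewrite codom_f eq_sym eqb_id ki => lt_k; exists (Ordinal lt_k) => //.
  by rewrite [LHS]surjective_pairing ki; congr pair; apply: val_inj.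
have := t_im (i, widen_ord le_la k).
rewrite /= ltn_ord => /eqP/codomP[x def_x]; exists x => //.
by apply/eqP; rewrite -def_x.
Qed.

Lemma projlift_Mspace n la mu (a : 'I_N) (v : wspace n) :
    is_partition n la -> v \in specht n la ->
  projlift mu a v \in Mspace n.+1 (incr_nth la a).
Proof.
move=> la_n /(specht_Mspace la_n)/(sh_Mspace a) v_M.
by apply: memv_suml => g _; apply/memvZ/act_Mspace.
Qed.

End Words.

Arguments specht F N n la : clear implicits.
Arguments Mspace F N m alpha : clear implicits.

(* Main.v *)
(* Write T for the sum over all ordered pairs (p, q) of the action of the
   transposition (p q), i.e. m + 2 * (sum of the transpositions of 'S_m).
   Inserting a letter a in a word w in all ways, then moving one letter or
   swapping two letters, gives the identity
     2 (R2R o sh_a - sh_a o R2R - (n + 1) sh_a) = T o sh_a - sh_a o T - sh_a.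
   Since T is central it acts by a scalar on S^la and on the mu-isotypic part,
   and the difference of these scalars is given by the content of the added
   box. The scalar is computed by characterising S^la as the space of highest
   weight vectors of weight la for gl_N acting on words. This description also
   shows that the span of the standard vectors w_t is stable under 'S_n, hence
   that its trace is a class function: the leading word of a highest weight
   vector is a lattice word, and so is that of a w_t with t standard. *)
From HB Require Import structures.
Require Import Defs.
From mathcomp Require Import all_boot all_order all_fingroup all_algebra.
From mathcomp Require Import zify ring.
(* Imported again because fingroup also defines act. *)
Require Import Defs.
Set Implicit Arguments.
Unset Strict Implicit.
Unset Printing Implicit Defensive.
Import GRing.Theory.
Local Open Scope ring_scope.

(** * Linearity and composition laws of the action on words *)

Section Action.

Variables (F : fieldType) (N : nat).

Lemma lin_ext_is_linear m (V : lmodType F) (f : word N m -> V) :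
  linear (lin_ext f : wspace F N m -> V).
Proof.
move=> c u v; rewrite /lin_ext scaler_sumr -big_split.
by apply: eq_bigr => w _; rewrite !ffunE scalerDl scalerA.
Qed.

HB.instance Definition _ m (V : lmodType F) (f : word N m -> V) :=
  GRing.isLinear.Build F (wspace F N m) V _ (lin_ext f) (lin_ext_is_linear f).

Lemma lin_ext_bword m (V : lmodType F) (f : word N m -> V) w :
  lin_ext f (bword F w) = f w.
Proof.
rewrite /lin_ext (bigD1 w) //= ffunE eqxx scale1r big1 ?addr0 // => w' ne.
by rewrite ffunE (negPf ne) scale0r.
Qed.

Lemma bword_sum m (v : wspace F N m) : v = \sum_w v w *: bword F w.
Proof.
apply/ffunP => w; rewrite sum_ffunE (bigD1 w) //= !ffunE eqxx big1 ?addr0.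
  by rewrite [LHS](esym (mulr1 _)).
by move=> w' ne; rewrite !ffunE eq_sym (negPf ne) scaler0.
Qed.

Lemma bword_ext m (V : lmodType F) (f g : {linear wspace F N m -> V}) :
  (forall w, f (bword F w) = g (bword F w)) -> f =1 g.
Proof.
move=> fg v; rewrite [v]bword_sum !linear_sum.
by apply: eq_bigr => w _; rewrite !linearZ /= fg.
Qed.

(** The product [(t * s)%g] applies [t] first, so composing right actions on words reverses the
    order of the factors. *)
Lemma word_actM m (w : word N m) s t :
  word_act (word_act w s) t = word_act w (t * s)%g.
Proof. by apply: eq_from_tnth => k; rewrite !tnth_mktuple permM. Qed.

Lemma word_act1 m (w : word N m) : word_act w 1%g = w.
Proof. by apply: eq_from_tnth => k; rewrite tnth_mktuple perm1. Qed.

Lemma act_bword m (w : word N m) s :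
  act (bword F w) s = bword F (word_act w s).
Proof. exact: lin_ext_bword. Qed.

Lemma actE m (v : wspace F N m) s w : act v s w = v (word_act w s^-1).
Proof.
rewrite /act /lin_ext sum_ffunE (bigD1 (word_act w s^-1)) //= !ffunE.
rewrite word_actM mulgV word_act1 eqxx big1 ?addr0.
  by rewrite [LHS](mulr1 (_ : F)).
move=> w' ne; rewrite !ffunE; case: eqP => [ww'|_]; last by rewrite scaler0.
by case/eqP: ne; rewrite ww' word_actM mulVg word_act1.
Qed.

Lemma actM m (v : wspace F N m) s t : act (act v s) t = act v (t * s)%g.
Proof. by apply/ffunP => w; rewrite !actE word_actM invMg. Qed.

Lemma act_sum m (I : finType) (u : I -> wspace F N m) s :
  act (\sum_i u i) s = \sum_i act (u i) s.
Proof. by rewrite {1}/act linear_sum. Qed.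

Lemma actZ m c (v : wspace F N m) s : act (c *: v) s = c *: act v s.
Proof. by rewrite {1}/act linearZ. Qed.

Lemma alg_actD m (v : wspace F N m) x y :
  alg_act v (x + y) = alg_act v x + alg_act v y.
Proof.
by rewrite -big_split; apply: eq_bigr => g _; rewrite ffunE scalerDl.
Qed.

Lemma alg_act_sum m (v : wspace F N m) (I : finType) (P : pred I) x :
  alg_act v (\sum_(i | P i) x i) = \sum_(i | P i) alg_act v (x i).
Proof.
rewrite /alg_act exchange_big; apply: eq_bigr => g _.
by rewrite sum_ffunE scaler_suml.
Qed.

Lemma alg_act_perm m (v : wspace F N m) s : alg_act v (alg_perm F s) = act v s.
Proof.
rewrite /alg_act (bigD1 s) //= ffunE eqxx scale1r big1 ?addr0 // => g ne.
by rewrite ffunE (negPf ne) scale0r.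
Qed.

Lemma alg_actMn m (v : wspace F N m) x d :
  alg_act v (x *+ d) = alg_act v x *+ d.
Proof.
rewrite /alg_act -sumrMnl; apply: eq_bigr => g _.
by rewrite ffunMnE scalerMnl.
Qed.

Lemma alg_act_is_linear m (x : {ffun 'S_m -> F}) :
  linear (fun v : wspace F N m => alg_act v x).
Proof.
move=> c u v; rewrite /alg_act scaler_sumr -big_split; apply: eq_bigr => g _.
by rewrite /act linearP scalerDr !scalerA mulrC.
Qed.

HB.instance Definition _ m := GRing.isLinear.Build F (wspace F N m)
  (wspace F N m) _ (@R2R F N m) (alg_act_is_linear (xi F m)).

HB.instance Definition _ m mu := GRing.isLinear.Build F (wspace F N m)
  (wspace F N m) _ (isoproj mu) (@alg_act_is_linear m _).

HB.instance Definition _ n (a : 'I_N) := GRing.isLinear.Build F (wspace F N n)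
  (wspace F N n.+1) _ (sh a) (lin_ext_is_linear _).

Lemma act1 m (v : wspace F N m) : act v 1%g = v.
Proof. by apply/ffunP => w; rewrite actE invg1 word_act1. Qed.

End Action.

(** * Inserting, removing and replacing letters *)

Section Shuffle.

Variables (F : fieldType) (N : nat).

Definition remove_word n (i : 'I_n.+1) (w : word N n.+1) : word N n :=
  [tuple tnth w (lift i k) | k < n].

Definition set_letter m (w : word N m) (k : 'I_m) (b : 'I_N) : word N m :=
  [tuple if i == k then b else tnth w i | i < m].

Lemma nth_insert_word x n (a : 'I_N) (j : 'I_n.+1) (w : word N n) k :
  nth x (insert_word a j w) k = if k == j then a else nth x w (unbump j k).
Proof.
rewrite insert_wordE nth_cat size_takel; last by rewrite size_tuple -ltnS.
rewrite /unbump; case: (ltngtP k j) => [ltkj|ltjk|->] /=.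
- by rewrite nth_take // subn0.
- by rewrite -[(k - j)%N]prednK ?subn_gt0 //= nth_drop subn1; congr nth; lia.
- by rewrite subnn.
Qed.

Lemma nth_remove_word x n (i : 'I_n.+1) (w : word N n.+1) k :
  nth x (remove_word i w) k = nth x w (bump i k).
Proof.
have [ltkn|lenk] := ltnP k n.
  by rewrite -[k]/(val (Ordinal ltkn)) -!tnth_nth tnth_mktuple (tnth_nth x).
rewrite !nth_default ?size_tuple // /bump; have := ltn_ord i; lia.
Qed.

Lemma nth_set_letter x m (w : word N m) (k : 'I_m) b i :
  nth x (set_letter w k b) i = if i == k then b else nth x w i.
Proof.
have [ltim|lemi] := ltnP i m.
  by rewrite -[i]/(val (Ordinal ltim)) -!tnth_nth tnth_mktuple (tnth_nth x).
rewrite !nth_default ?size_tuple // ifN //; have := ltn_ord k; lia.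
Qed.

Lemma tnth_set_letter m (w : word N m) k b i :
  tnth (set_letter w k b) i = if i == k then b else tnth w i.
Proof. exact: tnth_mktuple. Qed.

Lemma nth_word_act x m (w : word N m) s (k : 'I_m) :
  nth x (word_act w s) k = nth x w (s k).
Proof. by rewrite -!tnth_nth tnth_mktuple. Qed.

Lemma eq_word x m (w w' : word N m) :
  (forall k, (k < m)%N -> nth x w k = nth x w' k) -> w = w'.
Proof.
move=> eqw; apply/val_inj/(@eq_from_nth _ x); first by rewrite !size_tuple.
by move=> k; rewrite size_tuple; apply: eqw.
Qed.

Lemma tnth_insert_word n (a : 'I_N) (j : 'I_n.+1) (w : word N n) :
  tnth (insert_word a j w) j = a.
Proof. by rewrite (tnth_nth a) nth_insert_word eqxx. Qed.

Lemma tnth_insert_word_lift n (a : 'I_N) (j : 'I_n.+1) (w : word N n) k :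
  tnth (insert_word a j w) (lift j k) = tnth w k.
Proof.
rewrite !(tnth_nth a) nth_insert_word /= eq_sym (negPf (neq_bump _ _)).
by rewrite bumpK.
Qed.

Lemma remove_insert_word n (a : 'I_N) (j : 'I_n.+1) (w : word N n) :
  remove_word j (insert_word a j w) = w.
Proof.
by apply: eq_from_tnth => k; rewrite tnth_mktuple tnth_insert_word_lift.
Qed.

Lemma remove_insert_word_eq n (a : 'I_N) (i : 'I_n.+1) (w : word N n.+1) :
  remove_word (lift (widen_ord (leqnSn _) i) i)
    (insert_word a (widen_ord (leqnSn _) i) w) = set_letter w i a.
Proof.
apply: (eq_word (x := a)) => k ltk.
rewrite nth_remove_word nth_insert_word nth_set_letter /= /bump /unbump.
by do 2?[case: ifP => ?]; first [by [] | congr nth; lia | lia].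
Qed.

(** Inserting [a] just before or just after the letter i gives the same word once that letter is
    removed. The first case is [remove_insert_word_eq]; the other insertion positions correspond
    here to the positions j in the shorter word. *)
Lemma remove_insert_word_neq n (a : 'I_N) (i j : 'I_n.+1) (w : word N n.+1) :
  let k := lift (widen_ord (leqnSn _) i) j in
  remove_word (lift k i) (insert_word a k w)
  = insert_word a j (remove_word i w).
Proof.
move=> k; apply: (eq_word (x := a)) => l ltl.
rewrite nth_remove_word !nth_insert_word nth_remove_word /= /bump /unbump.
by do 2?[case: ifP => ?]; first [by [] | congr nth; lia | lia].
Qed.

Lemma sum_insert_wordC n (a b : 'I_N) (w : word N n) :
  \sum_(k < n.+2) \sum_(j < n.+1) bword F (insert_word b k (insert_word a j w))
  = \sum_(k < n.+2) \sum_(j < n.+1)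
      bword F (insert_word a k (insert_word b j w)).
Proof.
rewrite !pair_big /=.
(* With outer position k and inner position j, the inner letter ends at [lift k j]. The map [h]
   makes this the outer position and recovers k from it; the default [p.2] never occurs, since
   [lift k j] differs from k. *)
pose h (p : 'I_n.+2 * 'I_n.+1) : 'I_n.+2 * 'I_n.+1 :=
  (lift p.1 p.2, odflt p.2 (unlift (lift p.1 p.2) p.1)).
have hE p : lift (lift p.1 p.2) (h p).2 = p.1.
  rewrite /h /=; case: unliftP => [j //|/eqP].
  by rewrite (negPf (neq_lift _ _)).
have hK : involutive h.
  move=> p; have h1 : (h (h p)).1 = p.1 by apply: hE.
  have h2 : (h (h p)).2 = p.2.
    apply: (@lift_inj _ p.1).
    by have := hE (h p); rewrite [lift (h p).1 _](hE p).
  by rewrite [h (h p)]surjective_pairing h1 h2 -surjective_pairing.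
rewrite (reindex_inj (inv_inj hK)); apply: eq_bigr => p _; congr (bword F _).
apply: (eq_word (x := a)) => l ltl; rewrite !nth_insert_word.
have := congr1 val (hE p); rewrite /= => hE1.
move: (nat_of_ord (h p).2) hE1 => h2 ; rewrite /= /bump /unbump => hE1.
case: p hE1 => k j /= hE1.
by do 4?[case: ifP => ?]; first [by [] | congr nth; lia | lia].
Qed.

End Shuffle.

(** * Cycles of consecutive positions *)

Lemma next_iota u l k :
  next (iota u l) k
  = if (u <= k < u + l)%N then if (k.+1 < u + l)%N then k.+1 else u else k.
Proof.
rewrite next_nth mem_iota; case: ifP => // /andP[leuk ltkl].
have -> : index k (iota u l) = (k - u)%N.
  rewrite -[X in index X](subnKC leuk) -(@nth_iota 0 u l); last by lia.
  by rewrite index_uniq ?iota_uniq ?size_iota //; lia.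
case: l ltkl => [|l] ltkl /=; first by lia.
case: ifP => h; first by rewrite nth_iota; lia.
by rewrite nth_default // size_iota; lia.
Qed.

Lemma cycle_upE m (u v k : 'I_m) :
  cycle_up u v k
  = (if (u <= k < v.+1)%N then if (k < v)%N then k.+1 else u else k) :> nat.
Proof.
rewrite permE; set c := filter _ _.
have cU : uniq c by apply/filter_uniq/enum_uniq.
rewrite undup_id //.
have cE : map val c = iota u (v.+1 - u).
  rewrite /c -(filter_map _ (fun k => u <= k <= v)%N) val_enum_ord.
  apply: (irr_sorted_eq ltn_trans ltnn).
  - exact/(sorted_filter ltn_trans)/iota_ltn_sorted.
  - exact: iota_ltn_sorted.
  move=> x; rewrite mem_filter !mem_iota.
  by have := ltn_ord v; have := ltn_ord u; lia.
rewrite -[LHS](next_map val_inj) // cE next_iota /=.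
by have := ltn_ord v; have := ltn_ord u; do ?[case: ifP => ?]; lia.
Qed.

Lemma cycle_downE m (u v : 'I_m) : cycle_down u v = (cycle_up v u)^-1%g.
Proof.
apply: (mulIg (cycle_up v u)); rewrite mulVg; apply/permP => x.
rewrite permM perm1 !permE; set c := filter _ _.
have cU : uniq c by apply/filter_uniq/enum_uniq.
by rewrite !undup_id ?rev_uniq // next_rev // next_prev.
Qed.

(** * Random-to-random as removal and reinsertion of a letter *)

Section RandomToRandom.

Variables (F : fieldType) (N : nat).

Lemma insert_remove_word n (i : 'I_n.+1) (w : word N n.+1) :
  insert_word (tnth w i) i (remove_word i w) = w.
Proof.
apply: (eq_word (x := tnth w i)) => k _.
rewrite nth_insert_word nth_remove_word; case: eqP => [->|/eqP ne].
  by rewrite -tnth_nth.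
by rewrite unbumpK // inE.
Qed.

Lemma word_act_cycle_up n (w : word N n.+1) (u v : 'I_n.+1) :
  (u <= v)%N ->
  word_act w (cycle_up u v) = insert_word (tnth w u) v (remove_word u w).
Proof.
move=> leuv; apply: (eq_word (x := tnth w u)) => k ltk.
rewrite nth_insert_word nth_remove_word.
rewrite -[k]/(val (Ordinal ltk)) nth_word_act cycle_upE /=.
rewrite {2}(tnth_nth (tnth w u)) /bump /unbump.
by do ?[case: ifP => ?]; first [by [] | congr nth; lia | lia].
Qed.

Lemma word_act_cycle_down n (w : word N n.+1) (u v : 'I_n.+1) :
  (v <= u)%N ->
  word_act w (cycle_down u v) = insert_word (tnth w u) v (remove_word u w).
Proof.
move=> levu; set w' := insert_word _ _ _.
have {1}-> : w = word_act w' (cycle_up v u).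
  rewrite word_act_cycle_up // tnth_insert_word remove_insert_word.
  by rewrite insert_remove_word.
by rewrite word_actM cycle_downE mulVg word_act1.
Qed.

Lemma R2R_bword n (w : word N n.+1) :
  R2R (bword F w) = \sum_u \sum_v
    bword F (insert_word (tnth w u) v (remove_word u w)).
Proof.
rewrite pair_big /R2R /xi !alg_actD alg_actMn !alg_act_sum alg_act_perm act1.
rewrite [RHS](bigID (fun p : 'I_n.+1 * 'I_n.+1 => p.1 < p.2)%N) /=.
rewrite [X in _ = _ + X](bigID (fun p : 'I_n.+1 * 'I_n.+1 => p.2 < p.1)%N) /=.
rewrite -addrA [LHS]addrC -addrA; congr (_ + (_ + _)).
- apply: eq_bigr => p ltp.
  by rewrite alg_act_perm act_bword word_act_cycle_up // ltnW.
- apply: eq_big => p; first by lia.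
  by move=> ltp; rewrite alg_act_perm act_bword word_act_cycle_down // ltnW.
(* The remaining pairs have u = v and leave [w] unchanged; they account for the multiple of the
   identity in [xi]. *)
rewrite (reindex_onto (fun u => (u, u)) fst) /=; last first.
  by case=> u v /=; rewrite -!leqNgt -eqn_leq => /eqP/val_inj ->.
rewrite (eq_bigl predT) => [|u]; last by rewrite /= ltnn eqxx.
under eq_bigr do rewrite insert_remove_word.
by rewrite sumr_const card_ord.
Qed.

End RandomToRandom.

(** * Commutation of shuffling with random-to-random and with transpositions *)

Section Commutation.

Variables (F : fieldType) (N : nat).

Definition sum_tperm m (v : wspace F N m) : wspace F N m :=
  \sum_p \sum_q act v (tperm p q).

Lemma sum_tperm_is_linear m : linear (@sum_tperm m).
Proof.
move=> c u v; rewrite /sum_tperm scaler_sumr -big_split; apply: eq_bigr => p _.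
rewrite scaler_sumr -big_split; apply: eq_bigr => q _; exact: linearP.
Qed.

HB.instance Definition _ m := GRing.isLinear.Build F (wspace F N m)
  (wspace F N m) _ (@sum_tperm m) (@sum_tperm_is_linear m).

Lemma sh_bword n (a : 'I_N) (w : word N n) :
  sh a (bword F w) = \sum_j bword F (insert_word a j w).
Proof. exact: lin_ext_bword. Qed.

(** The correction term common to both commutators: [a] takes the place of a letter of [w], which is
    reinserted anywhere. *)
Definition sh_set_letter n (a : 'I_N) (w : word N n) : wspace F N n.+1 :=
  \sum_i \sum_k bword F (insert_word (tnth w i) k (set_letter w i a)).

(** Removing the inserted [a] and reinserting it gives [sh a (bword F w)] once for each of its
    [n.+1] initial positions. Removing a letter of [w] gives the first term, plus the correction
    coming from [remove_insert_word_eq]. *)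
Lemma R2R_sh_bword n (a : 'I_N) (w : word N n) :
  R2R (sh a (bword F w))
  = sh a (R2R (bword F w)) + sh a (bword F w) *+ n.+1 + sh_set_letter a w.
Proof.
rewrite sh_bword linear_sum /=.
under eq_bigr => j _.
  rewrite R2R_bword (bigD1_ord j) //= tnth_insert_word remove_insert_word.
  under [X in _ + X]eq_bigr do rewrite tnth_insert_word_lift.
  over.
rewrite big_split /= sumr_const card_ord addrAC addrC; congr (_ + _).
(* The empty word is treated apart, since [remove_word] requires positive length. *)
rewrite exchange_big /=; case: n w => [|n] w.
  rewrite /sh_set_letter !big_ord0 addr0 /R2R /xi.
  rewrite !alg_actD alg_actMn mulr0n !alg_act_sum !big1 ?addr0 ?linear0 //.
    by case=> -[].
  by case=> -[].
under eq_bigr => i _.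
  rewrite (bigD1_ord (widen_ord (leqnSn _) i)) //= remove_insert_word_eq.
  under [X in _ + X]eq_bigr do rewrite remove_insert_word_neq.
  (* So far [a] is inserted before the removed letter comes back; in [sh a (R2R _)] it is inserted
     afterwards. *)
  rewrite exchange_big sum_insert_wordC exchange_big.
  over.
rewrite big_split addrC /=; congr (_ + _).
rewrite R2R_bword linear_sum; apply: eq_bigr => i _.
by rewrite linear_sum; apply: eq_bigr => j _; rewrite /= sh_bword.
Qed.

(** In the longer word, the pair consisting twice of the position of [a] gives the second term, the
    pairs avoiding [a] give the first, and swapping [a] with a letter of [w] gives the correction
    once for each order of the pair. *)
Lemma sum_tperm_sh_bword n (a : 'I_N) (w : word N n) :
  sum_tperm (sh a (bword F w))
  = sh a (sum_tperm (bword F w)) + sh a (bword F w) + sh_set_letter a w *+ 2.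
Proof.
have tpermj j i : word_act (insert_word a j w) (tperm j (lift j i))
    = insert_word (tnth w i) j (set_letter w i a).
  apply: eq_from_tnth => k; rewrite tnth_mktuple.
  case: (unliftP j k) => [k' ->|->].
    rewrite tnth_insert_word_lift tnth_set_letter.
    case: (k' =P i) => [->|/eqP ne].
      by rewrite tpermR tnth_insert_word.
    rewrite tpermD ?tnth_insert_word_lift ?neq_lift //.
    by rewrite (inj_eq lift_inj) eq_sym.
  by rewrite tpermL tnth_insert_word tnth_insert_word_lift.
have tpermlift j i i' :
    word_act (insert_word a j w) (tperm (lift j i) (lift j i'))
    = insert_word a j (word_act w (tperm i i')).
  apply: eq_from_tnth => k; rewrite tnth_mktuple.
  case: (unliftP j k) => [k' ->|->].
    rewrite -inj_tperm ?tnth_insert_word_lift ?tnth_mktuple //.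
    exact: lift_inj.
  by rewrite tpermD ?tnth_insert_word // eq_sym neq_lift.
have shT : sh a (sum_tperm (bword F w))
    = \sum_j \sum_i \sum_i' bword F (insert_word a j (word_act w (tperm i i'))).
  rewrite [RHS]exchange_big linear_sum; apply: eq_bigr => i _.
  rewrite [RHS]exchange_big linear_sum; apply: eq_bigr => i1 _.
  by rewrite act_bword /= sh_bword.
rewrite shT sh_bword linear_sum [sh_set_letter a w]exchange_big mulr2n /=.
rewrite -!big_split; apply: eq_bigr => j _ /=.
rewrite /sum_tperm (bigD1_ord j) //= (bigD1_ord j) //= tperm1 act1.
under [X in _ + X + _]eq_bigr do rewrite act_bword tpermj.
under [X in _ + _ + X]eq_bigr => i _.
  rewrite (bigD1_ord j) //= tpermC act_bword tpermj.
  under [X in _ + X]eq_bigr do rewrite act_bword tpermlift.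
  over.
by rewrite big_split /= [LHS](AC (2*2) ((4*1)*(2*3))).
Qed.

(** The correction [sh_set_letter] occurs once in the first expansion and twice in the second, so
    doubling the first eliminates it. *)
Lemma R2R_sh n (a : 'I_N) (v : wspace F N n) :
  (R2R (sh a v) - sh a (R2R v) - sh a v *+ n.+1) *+ 2
  = sum_tperm (sh a v) - sh a (sum_tperm v) - sh a v.
Proof.
rewrite -[LHS]scaler_nat -[sh a v *+ _]scaler_nat.
pose f : {linear wspace F N n -> wspace F N n.+1} := 2%:R \*:
  ((@R2R F N n.+1 \o sh a) \- (sh a \o @R2R F N n) \- n.+1%:R \*: sh a).
pose g : {linear wspace F N n -> wspace F N n.+1} :=
  (@sum_tperm n.+1 \o sh a) \- (sh a \o @sum_tperm n) \- sh a.
apply: (bword_ext (f := f) (g := g)) => {v} w; rewrite /f /g /=.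
rewrite !scaler_nat R2R_sh_bword sum_tperm_sh_bword.
have cancel2 (V : zmodType) (x y z : V) : x + y + z - x - y = z.
  by rewrite -[_ - x - y]addrA -opprD addrC addKr.
by rewrite !cancel2.
Qed.

End Commutation.

(** * Highest weight vectors and the scalar of the transposition sum *)

Section HighestWeight.

Variables (F : fieldType) (N : nat).

(** The second condition reads off, at each word, the coefficient of [v] after the matrix unit that
    turns one letter b into a smaller letter a. *)
Definition highest_weight m (la : seq nat) (v : wspace F N m) : Prop :=
  (forall w, ~~ has_eval la w -> v w = 0) /\
  (forall (a b : 'I_N) w, (a < b)%N ->
     \sum_(k | tnth w k == a) v (set_letter w k b) = 0).

Lemma highest_weight_linear m la c (u v : wspace F N m) :
  highest_weight la u -> highest_weight la v -> highest_weight la (c *: u + v).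
Proof.
move=> [u_la u_hw] [v_la v_hw]; split=> [w w_la|a b w ltab].
  by rewrite !ffunE u_la ?v_la // scaler0 addr0.
under eq_bigr do rewrite !ffunE.
by rewrite big_split -scaler_sumr /= u_hw ?v_hw // scaler0 addr0.
Qed.

Lemma highest_weight0 m la : highest_weight la (0 : wspace F N m).
Proof. by split=> *; rewrite ?big1 // => *; rewrite ffunE. Qed.

Lemma has_eval_word_act m la (w : word N m) s :
  has_eval la (word_act w s) = has_eval la w.
Proof.
apply: eq_forallb => i; congr (_ == _); apply/seq.permP; rewrite perm_sym.
apply/tuple_permP; exists (s^-1)%g.
by rewrite -[w in LHS]word_act1 -(mulVg s) -word_actM.
Qed.

Lemma word_act_set_letter m (w : word N m) k b s :
  word_act (set_letter w k b) s^-1 = set_letter (word_act w s^-1) (s k) b.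
Proof.
apply: eq_from_tnth => i; rewrite tnth_mktuple !tnth_set_letter tnth_mktuple.
by rewrite -(inj_eq (@perm_inj _ s)) permKV.
Qed.

Lemma highest_weight_act m la (v : wspace F N m) s :
  highest_weight la v -> highest_weight la (act v s).
Proof.
move=> [v_la v_hw]; split=> [w w_la|a b w ltab].
  by rewrite actE v_la // has_eval_word_act.
rewrite -[RHS](v_hw a b (word_act w s^-1) ltab).
rewrite [RHS](reindex_inj (@perm_inj _ s)) /=.
apply: eq_big => [k|k _]; first by rewrite tnth_mktuple permK.
by rewrite actE word_act_set_letter.
Qed.

Lemma Mspace_support m al (v : wspace F N m) w :
  v \in Mspace F N m al -> ~~ has_eval al w -> v w = 0.
Proof.
move=> v_al w_al.
(* The extension of [f] keeps only the coefficient at [w], and kills the basis words of evaluation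
   [al]. *)
pose f w' : wspace F N m := (w' == w)%:R *: bword F w.
have : lin_ext f v \in 0%VS.
  apply: lin_ext_Mspace v_al => w' w'_al; rewrite memv0 /f.
  by case: (w' =P w) => [eqw|_]; [rewrite -eqw w'_al in w_al | rewrite scale0r].
rewrite memv0 /lin_ext (bigD1 w) //= big1 ?addr0 => [|w' /negPf ne].
  rewrite /f eqxx scale1r => /eqP/ffunP/(_ w).
  by rewrite !ffunE eqxx => /eqP; rewrite scaler_eq0 oner_eq0 orbF => /eqP.
by rewrite /f ne scale0r scaler0.
Qed.

Lemma sum_tnth m (w : word N m) al (V : nmodType) (f : 'I_N -> V) :
  has_eval al w -> \sum_k f (tnth w k) = \sum_b f b *+ nth 0%N al b.
Proof.
move=> /forallP w_al; rewrite (partition_big (tnth w) xpredT) //=.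
apply: eq_bigr => b _; rewrite -(eqP (w_al b)) -sum1_count big_tuple.
by rewrite -sumrMnr; apply: eq_bigr => k /eqP ->.
Qed.

(** For a partition of m with at most N rows, this is m plus twice the sum of the contents (column
    minus row) of its cells. *)
Definition content_sum (la : seq nat) : F :=
  \sum_(b < N) ((nth 0%N la b)%:R ^+ 2 - 2%:R * b%:R * (nth 0%N la b)%:R).

Lemma word_act_tperm m (w : word N m) p q :
  word_act w (tperm p q)
  = set_letter (set_letter w p (tnth w q)) q (tnth w p).
Proof.
apply: eq_from_tnth => k; rewrite tnth_mktuple !tnth_set_letter.
case: tpermP => [->|->|/eqP/negPf-> /eqP/negPf-> //]; rewrite !eqxx //.
by case: eqP => [->|].
Qed.

(** For fixed p, the q are split by comparing the letters at p and q. Equal letters each give [v w];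
    the smaller ones give [- v w] for each letter below [tnth w p], by the highest weight condition;
    the larger ones give the same total as the smaller ones, after exchanging p and q. *)
Lemma sum_tperm_highest_weight m la (v : wspace F N m) :
  highest_weight la v -> sum_tperm v = content_sum la *: v.
Proof.
have content_term (x : F) d k : (x *+ d) *+ d + (- (x *+ k)) *+ d
    + (- (x *+ k)) *+ d = (d%:R ^+ 2 - 2%:R * k%:R * d%:R) * x.
  by ring.
move=> [v_la v_hw]; apply/ffunP => w; rewrite ffunE.
have -> : sum_tperm v w = \sum_p \sum_q v (word_act w (tperm p q)).
  rewrite sum_ffunE; apply: eq_bigr => p _; rewrite sum_ffunE.
  by apply: eq_bigr => q _; rewrite actE tpermV.
have [w_la|w_la] := boolP (has_eval la w); last first.
  rewrite v_la // scaler0 big1 // => p _; rewrite big1 // => q _.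
  by rewrite v_la // has_eval_word_act.
(* Apply the highest weight condition to w with its letter at p lowered to a,
   for each a < tnth w p. *)
have lower p : \sum_(q | (tnth w q < tnth w p)%N) v (word_act w (tperm p q))
    = - (v w *+ tnth w p).
  apply/eqP; rewrite -addr_eq0.
  rewrite (partition_big (tnth w) (fun a => a < tnth w p)%N) //=.
  have -> : v w *+ tnth w p = \sum_(a : 'I_N | (a < tnth w p)%N) v w.
    rewrite sumr_const; congr (_ *+ _); rewrite -[LHS]card_ord.
    rewrite -(card_imset _ (f := widen_ord (ltnW (ltn_ord (tnth w p)))));
      last by move=> i j [] /val_inj.
    apply: eq_card => a; apply/imsetP/idP => [[i _ ->]|lta].
      exact: (ltn_ord i).
    by exists (Ordinal lta) => //; apply: val_inj.
  rewrite -big_split big1 //= => a lta.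
  rewrite -[RHS](v_hw a (tnth w p) (set_letter w p a) lta).
  rewrite [RHS](bigD1 p) /=; last by rewrite tnth_set_letter eqxx.
  rewrite addrC; congr (_ + _).
    congr (v _); apply: eq_from_tnth => k; rewrite !tnth_set_letter.
    by case: eqP => [->|].
  apply: eq_big => [q|q /andP[_ /eqP <-]]; last by rewrite word_act_tperm.
  rewrite tnth_set_letter; case: (q =P p) => [->|_] /=.
    by rewrite ltnn !andbF.
  by rewrite andbT; case: eqP => [->|]; rewrite ?lta ?andbF.
have split3 p : \sum_q v (word_act w (tperm p q))
    = v w *+ nth 0%N la (tnth w p)
      + \sum_(q | (tnth w q < tnth w p)%N) v (word_act w (tperm p q))
      + \sum_(q | (tnth w p < tnth w q)%N) v (word_act w (tperm p q)).
  rewrite (bigID (fun q => tnth w q < tnth w p)%N) /= -addrA addrCA.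
  congr (_ + _); rewrite addrC (bigID (fun q => tnth w p < tnth w q)%N) /=.
  congr (_ + _); first by apply: eq_bigl => q; lia.
  have /forallP/(_ (tnth w p))/eqP <- := w_la.
  rewrite -sum1_count big_tuple -sumrMnr; apply: eq_big => q.
    by rewrite -!leqNgt andbC -eqn_leq.
  rewrite -!leqNgt andbC -eqn_leq => /eqP/val_inj eqw; congr (v _).
  apply: eq_from_tnth => k; rewrite tnth_mktuple.
  by case: tpermP => // ->.
have upper :
    \sum_p \sum_(q | (tnth w p < tnth w q)%N) v (word_act w (tperm p q))
    = \sum_p \sum_(q | (tnth w q < tnth w p)%N) v (word_act w (tperm p q)).
  rewrite (exchange_big_dep xpredT) //=; apply: eq_bigr => p _.
  by apply: eq_bigr => q _; rewrite tpermC.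
under eq_bigr do rewrite split3.
rewrite !big_split /= upper.
under [X in _ + X + _]eq_bigr do rewrite lower.
under [X in _ + X]eq_bigr do rewrite lower.
rewrite (sum_tnth (fun b => v w *+ nth 0%N la b) w_la).
rewrite (sum_tnth (fun b : 'I_N => - (v w *+ b)) w_la).
rewrite -!big_split /= [RHS]mulr_suml; apply: eq_bigr => b _.
exact: content_term.
Qed.

End HighestWeight.

(** * Specht vectors are highest weight vectors *)

Section SpechtHighestWeight.

Variables (F : fieldType) (charF0 : [pchar F] =i pred0) (N : nat).

Lemma natf_eq0 k : (k%:R == 0 :> F) = (k == 0%N).
Proof. exact: (pcharf0P F).1. Qed.

Lemma eq_opp0 (x : F) : x = - x -> x = 0.
Proof.
move/eqP; rewrite -addr_eq0 -mulr2n -mulr_natl mulf_eq0 natf_eq0.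
by move/eqP.
Qed.

Lemma is_partition_geq n la a b :
  is_partition n la -> (a <= b)%N -> (nth 0%N la b <= nth 0%N la a)%N.
Proof.
case/and3P=> la_s _ _ leab; have [ltbl|lelb] := ltnP b (size la); last first.
  by rewrite nth_default.
apply: (sorted_leq_nth (leT := geq)) => //.
- by move=> x y z /= h1 h2; apply: leq_trans h2 h1.
- by move=> x /=.
- by rewrite inE (leq_ltn_trans leab).
Qed.

Lemma row_word_tab_perm n (s : 'S_n) (t : filling N n) k :
  tnth (row_word (tab_perm s t)) (s k) = (t k).1.
Proof. by rewrite tnth_mktuple ffunE permK. Qed.

Lemma row_word_tab_permP n (s : 'S_n) (t : filling N n) w :
  reflect (forall k, tnth w (s k) = (t k).1) (w == row_word (tab_perm s t)).
Proof.
apply: (iffP eqP) => [-> k|eqw]; first exact: row_word_tab_perm.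
by apply: eq_from_tnth => k; rewrite -(permKV s k) eqw row_word_tab_perm.
Qed.

Lemma col_stabM n (t : filling N n) j j' s :
  (t j).2 = (t j').2 -> s \in col_stab t -> (tperm j j' * s)%g \in col_stab t.
Proof.
move=> eqc; rewrite !inE => /forallP st; apply/forallP => k.
rewrite permM (eqP (st _)); case: tpermP => // ->; exact/eqP.
Qed.

Lemma specht_vecE n (t : filling N n) w :
  specht_vec F t w = \sum_(s | (s \in col_stab t)
    && (w == row_word (tab_perm s t))) (-1) ^+ odd_perm s.
Proof.
rewrite /specht_vec sum_ffunE big_mkcondr; apply: eq_bigr => s _ /=.
rewrite !ffunE; case: eqP => _; [exact: mulr1 | exact: mulr0].
Qed.

Lemma mem_specht_vec n la (t : filling N n) :
  is_standard la t -> specht_vec F t \in specht F N n la.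
Proof. by move=> t_la; apply/memv_span/image_f. Qed.

Lemma highest_weight_specht_vec n la (t : filling N n) :
  is_partition n la -> is_standard la t -> highest_weight la (specht_vec F t).
Proof.
move=> la_n t_la; split=> [w|a b w ltab].
  by apply/Mspace_support/(specht_Mspace la_n)/mem_specht_vec.
have /andP[/andP[/injectiveP t_inj /forallP t_im] _] := t_la.
under eq_bigr do rewrite specht_vecE.
rewrite (exchange_big_dep (mem (col_stab t))) /=; last by move=> k s _ /andP[].
under eq_bigr => s _ do rewrite (reindex_inj (@perm_inj _ s)).
rewrite (exchange_big_dep xpredT) //= big1 // => j _.
(* Precomposing s with the transposition of the entries j and j', which lie in
   the same column and in the rows b and a, is a sign-reversing involution. *)
pose B s := [&& s \in col_stab t, tnth w (s j) == a
  & set_letter w (s j) b == row_word (tab_perm s t)].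
rewrite (eq_bigl B) => [|s]; last by rewrite /B; case: (s \in _).
have [tjb|tjb] := eqVneq (t j).1 b; last first.
  rewrite big1 // => s /and3P[_ _ /row_word_tab_permP ws].
  by have := ws j; rewrite tnth_set_letter eqxx => eqb; case/eqP: tjb.
(* As a < b, row a is at least as long as row b, so the column of [j] also meets row a. *)
have /codomP[j' tj'] : (a, (t j).2) \in codom t.
  have := t_im (a, (t j).2); rewrite /= => /eqP ->.
  have := t_im (t j); rewrite codom_f eq_sym eqb_id tjb => lt_b.
  by apply: leq_trans lt_b _; apply/(is_partition_geq la_n)/ltnW.
have ne_jj' : j' != j.
  by apply: contraTneq ltab => ejj'; rewrite -tjb -ejj' -tj' ltnn.
have BM s : B s -> B (tperm j j' * s)%g.
  case/and3P=> st wsj /row_word_tab_permP ws; rewrite /B.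
  have wsj' : tnth w (s j') = a.
    have := ws j'; rewrite tnth_set_letter (inj_eq perm_inj) (negPf ne_jj').
    by rewrite -tj'.
  rewrite col_stabM // -?tj' // permM tpermL wsj' eqxx.
  apply/row_word_tab_permP => k; rewrite permM tnth_set_letter.
  rewrite (inj_eq perm_inj); case: tpermP => [->|->|/eqP nj /eqP nj'].
  - by rewrite eqxx tjb.
  - by rewrite eq_sym (negPf ne_jj') (eqP wsj) -tj'.
  - by rewrite (negPf nj') -ws tnth_set_letter (inj_eq perm_inj) (negPf nj).
apply: eq_opp0.
rewrite [LHS](reindex_inj (mulgI (tperm j j'))) -sumrN.
apply: eq_big => s; last first.
  by rewrite odd_mul_tperm eq_sym ne_jj' signrN.
apply/idP/idP; last by move=> h; apply: BM.
by move/BM; rewrite mulgA tperm2 mul1g.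
Qed.

Lemma highest_weight_specht n la (v : wspace F N n) :
  is_partition n la -> v \in specht F N n la -> highest_weight la v.
Proof.
move=> la_n v_la; rewrite (coord_span v_la).
elim/big_rec: _ => [|i x _ hx]; first exact: highest_weight0.
apply: highest_weight_linear hx.
have : nth 0 [seq specht_vec F t | t : filling N n in is_standard la] i
    \in [seq specht_vec F t | t : filling N n in is_standard la].
  by rewrite mem_nth ?size_image.
by move=> /imageP[t t_la ->]; apply: highest_weight_specht_vec.
Qed.

End SpechtHighestWeight.

(** * Raising and lowering operators on selected positions *)

Section Raising.

Variables (F : fieldType) (charF0 : [pchar F] =i pred0) (N m : nat).
Variable P : pred 'I_m.

Definition letter_count (a : 'I_N) (w : word N m) : nat :=
  #|[set k | P k && (tnth w k == a)]|.

(* For a < b, [raise a b] is the action of the matrix unit E_(a, b) of gl_N on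
   the tensor factors selected by P. *)
Definition raise (a b : 'I_N) (f : word N m -> F) (w : word N m) : F :=
  \sum_(k | P k && (tnth w k == a)) f (set_letter w k b).

Lemma letter_count_set_letter a b w k :
  a != b -> P k -> tnth w k = b ->
  letter_count a (set_letter w k a) = (letter_count a w).+1 /\
  letter_count b w = (letter_count b (set_letter w k a)).+1.
Proof.
move=> ne_ab Pk wk; split.
  rewrite -add1n /letter_count (cardsD1 k) inE Pk tnth_set_letter !eqxx.
  congr (_ + _)%N; apply: eq_card => i; rewrite !inE tnth_set_letter.
  by case: (i =P k) => [->|] //=; rewrite wk eq_sym (negPf ne_ab) andbF.
rewrite -add1n /letter_count (cardsD1 k) inE Pk wk eqxx.
congr (_ + _)%N; apply: eq_card => i; rewrite !inE tnth_set_letter.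
by case: (i =P k) => [->|] //=; rewrite (negPf ne_ab) andbF.
Qed.

(** The count comes from changing the same position twice, the double sum from changing two distinct
    positions. *)
Lemma raise_raise a b f w : a != b ->
  raise a b (raise b a f) w = f w *+ letter_count a w
    + \sum_(k | P k && (tnth w k == a)) \sum_(l | P l && (tnth w l == b))
        f (set_letter (set_letter w k b) l a).
Proof.
move=> ne_ab; rewrite /letter_count cardE -sum1_size big_enum /= -sumrMnr.
under [X in _ = X + _]eq_bigl do rewrite inE.
rewrite -big_split; apply: eq_bigr => k /andP[Pk /eqP wk] /=.
rewrite /raise (bigD1 k) /=; last by rewrite Pk tnth_set_letter !eqxx.
congr (_ + _).
  congr (f _); apply: eq_from_tnth => i; rewrite !tnth_set_letter.
  by case: eqP => [->|].
apply: eq_bigl => l; rewrite tnth_set_letter.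
case: (l =P k) => [->|_]; last by rewrite andbT.
by rewrite wk (negPf ne_ab) !andbF.
Qed.

(** This is the relation [E_(a, b), E_(b, a)] = E_(a, a) - E_(b, b); the double sums of
    [raise_raise] cancel by symmetry. *)
Lemma raise_comm a b f w : a != b ->
  raise a b (raise b a f) w + f w *+ letter_count b w
  = raise b a (raise a b f) w + f w *+ letter_count a w.
Proof.
move=> ne_ab; have ne_ba : b != a by rewrite eq_sym.
rewrite (raise_raise f w ne_ab) (raise_raise f w ne_ba) exchange_big.
rewrite [LHS](AC (2*1) ((3*2)*1)); congr (_ + _ + _).
apply: eq_bigr => k /andP[_ /eqP wk]; apply: eq_bigr => l /andP[_ /eqP wl].
congr (f _); apply: eq_from_tnth => i; rewrite !tnth_set_letter.
case: (i =P k) => [eik|//]; case: (i =P l) => // eil.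
by case/eqP: ne_ab; rewrite -wk -wl -eik -eil.
Qed.

Lemma iter_raise_support a b alpha beta f j w : a != b ->
    (forall w, f w != 0 ->
       letter_count a w = alpha /\ letter_count b w = beta) ->
  iter j (raise b a) f w != 0 ->
  (letter_count a w + j = alpha)%N /\ letter_count b w = (beta + j)%N.
Proof.
move=> ne_ab f_wt; elim: j w => [|j IH] w /= fw.
  by rewrite !addn0; apply: f_wt.
have [k /andP[/andP[Pk /eqP wk] /IH[cnt_a cnt_b]]] :
    exists k, (P k && (tnth w k == b))
      && (iter j (raise b a) f (set_letter w k a) != 0).
  apply/existsP; apply: contraR fw => /existsPn no_k.
  rewrite /raise big1 // => k Pwk.
  by apply/eqP; have := no_k k; rewrite Pwk negbK.
have [] := letter_count_set_letter ne_ab Pk wk; lia.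
Qed.

(* The sl_2 fact that a highest weight vector has a dominant weight: raising
   the successive lowerings f_j of f gives - c_j f_(j - 1) with c_j > 0, while
   f_j = 0 for large j. *)
Lemma raise_eq0 a b alpha beta f : a != b ->
    (forall w, raise a b f w = 0) ->
    (forall w, f w != 0 ->
       letter_count a w = alpha /\ letter_count b w = beta) ->
  (alpha < beta)%N -> forall w, f w = 0.
Proof.
move=> ne_ab f_raise f_wt lt_ab.
have comm j w (g := iter j (raise b a) f) :
    raise a b (raise b a g) w
    = raise b a (raise a b g) w - g w *+ (beta - alpha + j.*2).
  have := raise_comm g w ne_ab; have [-> |] := eqVneq (g w) 0.
    by rewrite !mul0rn !addr0 subr0.
  move=> /(iter_raise_support ne_ab f_wt)[cnt_a cnt_b].
  rewrite (_ : letter_count b w = letter_count a w + (beta - alpha + j.*2))%N.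
    by rewrite mulrnDr addrA addrAC => /addIr <-; rewrite addrK.
  by lia.
(* The constant is the sum of [beta - alpha + i.*2] over i <= j, positive because [alpha < beta]. *)
have rec j : exists2 c, (0 < c)%N & forall w,
    raise a b (iter j.+1 (raise b a) f) w = - (iter j (raise b a) f w *+ c).
  elim: j => [|j [c c_gt0 IH]].
    exists (beta - alpha + 0.*2)%N => [|w]; first by rewrite addn0 subn_gt0.
    rewrite (comm 0%N) [X in X - _]big1 ?sub0r // => k _; exact: f_raise.
  exists (c + (beta - alpha + j.+1.*2))%N => [|w]; first by rewrite ltn_addr.
  rewrite (comm j.+1) [in RHS]mulrnDr opprD; congr (_ - _).
  under [LHS]eq_bigr do rewrite IH.
  by rewrite sumrN sumrMnl.
(* Descent from the lowering of order [alpha.+1], which is zero for weight reasons, to [f] itself;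
   each step divides by a positive integer. *)
have vanish j w : iter (alpha.+1 - j) (raise b a) f w = 0.
  elim: j w => [|j IH] w.
    rewrite subn0; apply/eqP/negPn/negP.
    by move=> /(iter_raise_support ne_ab f_wt); lia.
  have [ltja|leaj] := ltnP j alpha.+1; last first.
    by have := IH w; rewrite (_ : alpha.+1 - j = alpha.+1 - j.+1)%N //; lia.
  have [c c_gt0 cE] := rec (alpha.+1 - j.+1)%N.
  have := cE w.
  rewrite (_ : (alpha.+1 - j.+1).+1 = alpha.+1 - j)%N; last by lia.
  rewrite /raise big1 => [/eqP|k _]; last exact: IH.
  rewrite eq_sym oppr_eq0 -mulr_natr mulf_eq0 (natf_eq0 charF0).
  case/orP=> [/eqP //|].
  by rewrite gtn_eqF.
by move=> w; rewrite -(vanish alpha.+1 w) subnn.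
Qed.

End Raising.

(** * Leading words of Specht vectors and of highest weight vectors *)

Section LeadingWord.

Variables (F : fieldType) (charF0 : [pchar F] =i pred0) (N : nat).

(* Words of the same length are compared by their codes, i.e. in the
   lexicographic order starting from the last letter. *)
Fixpoint word_code (s : seq 'I_N) : nat :=
  if s is x :: s' then x + N * word_code s' else 0.

Lemma word_code_inj s s' :
  size s = size s' -> word_code s = word_code s' -> s = s'.
Proof.
elim: s s' => [|x s IH] [|x' s'] //= [eqsz] eqcode.
have eqx : x = x' :> nat.
  rewrite -(modn_small (ltn_ord x)) -(modn_small (ltn_ord x')).
  rewrite -(modnMDl (word_code s)) -[RHS](modnMDl (word_code s')).
  by rewrite ![(_ * N + _)%N]addnC ![(_ * N)%N]mulnC eqcode.
rewrite (val_inj eqx) (IH s') //; move: eqcode; rewrite eqx => /addnI/eqP.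
by rewrite eqn_pmul2l ?(leq_ltn_trans _ (ltn_ord x)) // => /eqP.
Qed.

Lemma word_code_lt (x0 : 'I_N) s s' k : size s = size s' -> (k < size s)%N ->
    (nth x0 s k < nth x0 s' k)%N ->
    (forall j, (k < j)%N -> nth x0 s j = nth x0 s' j) ->
  (word_code s < word_code s')%N.
Proof.
elim: s s' k => [|x s IH] [|x' s'] //= [|k] [eqsz] ltk /= lt eqs.
  rewrite (_ : s = s') ?ltn_add2r //.
  by apply: (@eq_from_nth _ x0) => // j _; apply: (eqs j.+1).
have := IH s' k eqsz ltk lt (fun j => eqs j.+1).
have := ltn_ord x; nia.
Qed.

Lemma word_code_lt_tnth n (w w' : word N n) k :
    (tnth w k < tnth w' k)%N ->
    (forall j : 'I_n, (k < j)%N -> tnth w j = tnth w' j) ->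
  (word_code w < word_code w')%N.
Proof.
move=> ltk eqw; apply: (word_code_lt (x0 := tnth w k) (k := k)).
- by rewrite !size_tuple.
- by rewrite size_tuple.
- by rewrite -!tnth_nth.
move=> j ltkj; have [ltjn|lenj] := ltnP j n.
  rewrite -[LHS](tnth_nth _ w (Ordinal ltjn)).
  rewrite -[RHS](tnth_nth _ w' (Ordinal ltjn)).
  exact: eqw.
by rewrite !nth_default ?size_tuple.
Qed.

(** At the last position k where the words differ, [w] has the row of another entry i of the column
    of k. If that row were below k, then i > k by standardness, but the permutation fixes all
    entries above k. *)
Lemma specht_vec_leading n la (t : filling N n) w :
  is_standard la t -> specht_vec F t w != 0 -> w != row_word t ->
  (word_code w < word_code (row_word t))%N.
Proof.
case/andP=> /andP[/injectiveP t_inj _] /forallP t_st.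
rewrite specht_vecE => nz ne.
have [s] : exists s, (s \in col_stab t) && (w == row_word (tab_perm s t)).
  apply/existsP; apply: contraR nz => /existsPn no_s.
  by rewrite big_pred0 // => s; apply/negbTE.
case/andP; rewrite inE => /forallP st /row_word_tab_permP ws.
have [k0 k0P] : exists k, tnth w k != (t k).1.
  apply/existsP; apply: contraR ne => /existsPn eqw.
  apply/eqP/eq_from_tnth => k.
  by rewrite tnth_mktuple; apply/eqP; rewrite -[_ == _]negbK.
case: (@arg_maxnP _ k0 (fun k => tnth w k != (t k).1) (@nat_of_ord n) k0P) => k.
move=> kP k_max.
have eqw (j : 'I_n) : (k < j)%N -> tnth w j = (t j).1.
  by move=> ltkj; apply/eqP; apply: contraLR ltkj => /k_max; rewrite -leqNgt.
apply: (word_code_lt_tnth (k := k)) => [|j ltkj]; last first.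
  by rewrite tnth_mktuple eqw.
(* The entry sent to [j] lies in the same column as [j], and in the same row by agreement of the
   words, so it is [j]. *)
have s_fix (j : 'I_n) : (k < j)%N -> s j = j.
  move=> ltkj; rewrite -[j in LHS](_ : (s^-1)%g j = j) ?permKV //.
  apply: t_inj; rewrite [LHS]surjective_pairing [RHS]surjective_pairing.
  by rewrite -ws permKV eqw // -(eqP (st _)) permKV.
set i := (s^-1)%g k; have si : s i = k by rewrite permKV.
rewrite tnth_mktuple -si ws si ltn_neqAle.
have ne1 : (t i).1 != (t k).1 by rewrite -ws si.
rewrite (inj_eq val_inj) ne1 leqNgt; apply/negP => ltki.
have /forallP/(_ i)/andP[_ /implyP] := t_st k.
rewrite -(eqP (st i)) si eqxx ltki => /(_ isT) /s_fix; rewrite si => eki.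
by case/eqP: ne1; rewrite -eki.
Qed.

Lemma specht_vec_row_word n la (t : filling N n) :
  is_standard la t -> specht_vec F t (row_word t) = 1.
Proof.
case/andP=> /andP[/injectiveP t_inj _] _.
rewrite specht_vecE (bigD1 1%g) /=; last first.
  rewrite inE; apply/andP; split; first by apply/forallP => k; rewrite perm1.
  by apply/row_word_tab_permP => k; rewrite perm1 tnth_mktuple.
rewrite odd_perm1 big1 ?addr0 // => s /andP[/andP[]].
rewrite inE => /forallP st /row_word_tab_permP ws /eqP[].
apply/permP => k; rewrite perm1; apply: t_inj.
have := ws k; rewrite tnth_mktuple => eqr.
by rewrite [LHS]surjective_pairing [RHS]surjective_pairing eqr (eqP (st k)).
Qed.

(** A prefix of [w0] with more b than a would yield a nonzero vector contradicting [raise_eq0]. *)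
Lemma leading_word_lattice n la (v : wspace F N n) w0 p (a b : 'I_N) :
    highest_weight la v -> v w0 != 0 ->
    (forall w, v w != 0 -> (word_code w <= word_code w0)%N) -> (a < b)%N ->
  (letter_count [pred k : 'I_n | k < p]%N b w0
     <= letter_count [pred k : 'I_n | k < p]%N a w0)%N.
Proof.
move=> [v_la v_hw] nz w0_max ltab; set P := [pred k : 'I_n | (k < p)%N].
have ne_ab : a != b by apply: contraTneq ltab => ->; rewrite ltnn.
(* The part of v with the same letters as w0 from position p on is still
   killed by raising the first p letters, by maximality of w0. *)
pose agree w := [forall k, ~~ P k ==> (tnth w k == tnth w0 k)].
pose f w : F := if agree w then v w else 0.
have f_supp w : f w != 0 -> has_eval la w /\ agree w.
  rewrite /f; case: ifP; rewrite ?eqxx // => _ vw; split=> //.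
  by apply: contraNT vw => /v_la ->.
have agree_set w k c : P k -> agree (set_letter w k c) = agree w.
  move=> Pk; apply: eq_forallb => i; rewrite tnth_set_letter.
  by case: (i =P k) => [->|//]; rewrite Pk.
have f_raise w : raise P a b f w = 0.
  have [w_w0|w_w0] := boolP (agree w); last first.
    by apply: big1 => k /andP[Pk _]; rewrite /f agree_set // (negPf w_w0).
  rewrite -[RHS](v_hw a b w ltab) [RHS](bigID P) /= [X in _ + X]big1 ?addr0.
    apply: eq_big => [k|k /andP[Pk _]]; first by rewrite andbC.
    by rewrite /f agree_set // w_w0.
  move=> k /andP[/eqP wk Pk]; apply/eqP; apply: contraTT isT => /w0_max.
  rewrite leqNgt => /negP[]; move/forallP: w_w0 => w_w0.
  apply: (word_code_lt_tnth (k := k)).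
    have := w_w0 k; rewrite Pk tnth_set_letter eqxx /= => /eqP <-.
    by rewrite wk.
  move=> j ltkj; rewrite tnth_set_letter; case: eqP => [eqjk|_].
    by move: ltkj; rewrite eqjk ltnn.
  apply/esym/eqP; have := w_w0 j; rewrite (_ : ~~ P j) //.
  by move: Pk; rewrite /P /=; lia.
(* Both words have evaluation [la] and agree outside the prefix, so they have the same letters
   inside it. *)
have count_agree w c : f w != 0 -> letter_count P c w = letter_count P c w0.
  have split_count w' : has_eval la w' -> (letter_count P c w'
      + letter_count (predC P) c w')%N = nth 0%N la c.
    move=> /forallP/(_ c)/eqP <-; rewrite /letter_count !cardsE -sum1_count.
    rewrite big_tuple (bigID P) /= -!sum1_card.
    by congr (_ + _)%N; apply: eq_bigl => k; rewrite andbC.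
  case/f_supp=> w_la w_w0; have w0_la : has_eval la w0.
    by apply: contraNT nz => /v_la ->.
  have := split_count w0 w0_la; rewrite -(split_count w w_la).
  suff -> : letter_count (predC P) c w = letter_count (predC P) c w0 by lia.
  apply: eq_card => k; rewrite !inE; case: (boolP (k < p)%N) => //= Pk.
  by move/forallP/(_ k): w_w0; rewrite Pk => /eqP ->.
rewrite leqNgt; apply: contraNN nz => lt_cnt.
have := raise_eq0 charF0 ne_ab f_raise
  (fun w fw => conj (count_agree w a fw) (count_agree w b fw)) lt_cnt w0.
by rewrite /f ifT => [->//|]; apply/forallP => k; rewrite eqxx implybT.
Qed.

End LeadingWord.

(** * Standard tableaux from lattice words *)

Section LatticeTableau.

Variables (N n : nat).

Definition prefix_count (a : 'I_N) (w : word N n) (p : nat) : nat :=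
  letter_count [pred k : 'I_n | k < p]%N a w.

Lemma prefix_count_leq a w p q :
  (p <= q)%N -> (prefix_count a w p <= prefix_count a w q)%N.
Proof.
move=> lepq; apply/subset_leq_card/subsetP => k; rewrite !inE.
by case/andP=> /leq_trans -> // ->.
Qed.

Lemma prefix_countS w (k : 'I_n) :
  prefix_count (tnth w k) w k.+1 = (prefix_count (tnth w k) w k).+1.
Proof.
rewrite -add1n /prefix_count /letter_count (cardsD1 k) inE /= ltnSn eqxx.
congr (_ + _)%N; apply: eq_card => i; rewrite !inE /= ltnS ltn_neqAle andbA.
by rewrite (inj_eq val_inj).
Qed.

Lemma prefix_count_ltn w (k : 'I_n) : (prefix_count (tnth w k) w k < n)%N.
Proof.
rewrite -prefix_countS -[X in (_ <= X)%N]card_ord; exact: max_card.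
Qed.

Lemma prefix_count_size la w a :
  has_eval la w -> prefix_count a w n = nth 0%N la a.
Proof.
move=> /forallP/(_ a)/eqP <-.
rewrite /prefix_count /letter_count -sum1_count big_tuple -sum1_card.
by apply: eq_bigl => k; rewrite inE /= ltn_ord.
Qed.

(** The count grows by at most one per letter, so it equals [c] just before the shortest prefix
    where it exceeds [c]. *)
Lemma prefix_count_onto w a c :
  (c < prefix_count a w n)%N ->
  exists k : 'I_n, tnth w k = a /\ prefix_count a w k = c.
Proof.
move=> ltc.
case: (ex_minnP (ex_intro (fun p => c < prefix_count a w p)%N n ltc)).
case=> [|p] ltcp p_min.
  move: ltcp; rewrite /prefix_count /letter_count.
  by rewrite (_ : [set _ | _] = set0) ?cards0 //; apply/setP => k; rewrite !inE.
have lepc : (prefix_count a w p <= c)%N.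
  by rewrite leqNgt; apply/negP => /p_min; rewrite ltnn.
have ltpn : (p < n)%N by apply: p_min.
exists (Ordinal ltpn); have [wp|ne] := eqVneq (tnth w (Ordinal ltpn)) a.
  split=> //; apply/eqP; rewrite eqn_leq lepc /=.
  by rewrite -wp -ltnS -(prefix_countS w (Ordinal ltpn)) wp.
move: ltcp; rewrite ltnNge (leq_trans _ lepc) //.
apply/subset_leq_card/subsetP => k; rewrite !inE /= ltnS leq_eqVlt.
case/andP=> /orP[/eqP eqk|-> ->//] /eqP wk; case/eqP: ne; rewrite -wk.
by congr tnth; apply: val_inj.
Qed.

(** The classical correspondence: each entry k is appended to the row given by the k-th letter, so
    its column counts the earlier occurrences of that letter. *)
Definition lattice_tableau (w : word N n) : filling N n :=
  [ffun k => (tnth w k, Ordinal (prefix_count_ltn w k))].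

Lemma row_word_lattice_tableau w : row_word (lattice_tableau w) = w.
Proof. by apply: eq_from_tnth => k; rewrite tnth_mktuple ffunE. Qed.

Lemma lattice_tableau_standard la w :
    has_eval la w ->
    (forall p (a b : 'I_N), (a < b)%N ->
       (prefix_count b w p <= prefix_count a w p)%N) ->
  is_standard la (lattice_tableau w).
Proof.
move=> w_la w_lattice; apply/andP; split; first (apply/andP; split).
- have inj_lt (j k : 'I_n) : tnth w j = tnth w k -> (j < k)%N ->
      (prefix_count (tnth w j) w j < prefix_count (tnth w k) w k)%N.
    by move=> <- ltjk; rewrite -prefix_countS prefix_count_leq.
  apply/injectiveP => j k; rewrite !ffunE => -[eqw eqc]; apply: val_inj.
  have [ltjk|ltkj|//] := ltngtP j k.
    by have := inj_lt j k eqw ltjk; rewrite eqc ltnn.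
  by have := inj_lt k j (esym eqw) ltkj; rewrite eqc ltnn.
- apply/forallP => -[a c] /=; apply/eqP; apply/idP/idP.
    case/codomP => k; rewrite ffunE => -[-> ->] /=.
    by rewrite -(prefix_count_size _ w_la) -prefix_countS prefix_count_leq.
  rewrite -(prefix_count_size _ w_la) => /prefix_count_onto[k [wk ck]].
  apply/codomP; exists k; rewrite ffunE; congr pair => //.
  by apply: val_inj; rewrite /= wk ck.
apply/forallP => j; apply/forallP => k; rewrite !ffunE /=; apply/andP; split.
  apply/implyP => /andP[/eqP eqw]; rewrite eqw; apply: contraTT.
  by rewrite -!leqNgt; apply: prefix_count_leq.
apply/implyP => /andP[/eqP[eqc] ltw]; rewrite ltnNge; apply/negP => lekj.
have ltkj : (k < j)%N.
  rewrite ltn_neqAle lekj andbT; apply: contraTneq ltw => /val_inj ->.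
  by rewrite ltnn.
(* If k came before j, then just after k the letter of k would have occurred once more than the
   smaller letter of j, against the lattice condition. *)
have := prefix_count_leq (tnth w j) w ltkj.
have := w_lattice k.+1 _ _ ltw; rewrite prefix_countS -eqc.
by move=> h1 h2; have := leq_trans h1 h2; rewrite ltnn.
Qed.

End LatticeTableau.

(** * Stability of the Specht module, its character and the isotypic projection *)

Section SpechtModule.

Variables (F : fieldType) (charF0 : [pchar F] =i pred0) (N : nat).

(** Triangular elimination: the leading word of [v] is the row word of a standard tableau, and
    subtracting a multiple of its Specht vector lowers the leading word. The induction is on a
    strict bound [B] for the codes in the support. *)
Lemma specht_highest_weight n la (v : wspace F N n) :
  is_partition n la -> highest_weight la v -> v \in specht F N n la.
Proof.
move=> la_n; have [B] : exists B, forall w, v w != 0 -> (word_code w < B)%N.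
  exists (\max_(w : word N n) word_code w).+1 => w _; exact: leq_bigmax.
elim: B v => [|B IH] v v_B v_hw.
  suff -> : v = 0 by apply: mem0v.
  by apply/ffunP => w; rewrite ffunE; apply/eqP/negPn/negP => /v_B.
have [/existsP[w0 /andP[nz /eqP w0_B]]|/existsPn no_w] :=
    boolP [exists w, (v w != 0) && (word_code w == B)]; last first.
  apply: IH => // w vw; have := v_B w vw.
  rewrite ltnS leq_eqVlt => /orP[eqB|//].
  by have := no_w w; rewrite vw eqB.
have w0_max w : v w != 0 -> (word_code w <= word_code w0)%N.
  by rewrite w0_B -ltnS; apply: v_B.
have w0_la : has_eval la w0 by apply: contraNT nz => /v_hw.1 ->.
have t_la := lattice_tableau_standard w0_la
  (fun p a b => leading_word_lattice charF0 p v_hw nz w0_max).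
set t := lattice_tableau w0 in t_la.
have tw0 : row_word t = w0 := row_word_lattice_tableau w0.
rewrite -[v](subrK (v w0 *: specht_vec F t)) memvD ?memvZ ?mem_specht_vec //.
apply: IH; last first.
  rewrite addrC -scaleNr; apply: highest_weight_linear v_hw.
  exact: highest_weight_specht_vec.
move=> w; rewrite !ffunE; have [->|ne] := eqVneq w w0.
  rewrite -[X in specht_vec _ _ X]tw0 (specht_vec_row_word _ t_la).
  by rewrite [_ *: _]mulr1 subrr eqxx.
rewrite -w0_B; have [tw|tw] := eqVneq (specht_vec F t w) 0.
  rewrite tw scaler0 subr0 => /w0_max; rewrite leq_eqVlt => /orP[/eqP eqc|//].
  by case/eqP: ne; apply/val_inj/word_code_inj; rewrite ?size_tuple.
by move=> _; rewrite -[in X in (_ < X)%N]tw0 (specht_vec_leading t_la tw) ?tw0.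
Qed.

Lemma specht_act n la (v : wspace F N n) s :
  is_partition n la -> v \in specht F N n la -> act v s \in specht F N n la.
Proof.
move=> la_n /(highest_weight_specht charF0 la_n) v_hw.
exact/specht_highest_weight/highest_weight_act.
Qed.

(** By stability, both sides are traces of products of the matrices of [g] and [h] in [vbasis], in
    opposite orders. *)
Lemma specht_charC n la (g h : 'S_n) :
  is_partition n la ->
  specht_char F N la (g * h)%g = specht_char F N la (h * g)%g.
Proof.
move=> la_n; rewrite /specht_char /=; set b := vbasis _.
set d := \dim _ in b *.
have trM (s t : 'S_n) : \sum_(i < d) coord b i (act b`_i (s * t)%g)
    = \sum_(i < d) \sum_(j < d) coord b j (act b`_i t) * coord b i (act b`_j s).
  apply: eq_bigr => i _; rewrite -actM.
  have bi : act b`_i t \in specht F N n la.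
    by apply/specht_act => //; apply/vbasis_mem/mem_nth; rewrite size_tuple.
  rewrite {1}(coord_vbasis bi) act_sum linear_sum; apply: eq_bigr => j _.
  by rewrite actZ linearZ.
rewrite !trM exchange_big; apply: eq_bigr => i _; apply: eq_bigr => j _.
exact: mulrC.
Qed.

(** The coefficients form a class function, so the element of the group algebra is central. *)
Lemma isoproj_act n la (v : wspace F N n) s :
  is_partition n la -> isoproj la (act v s) = act (isoproj la v) s.
Proof.
move=> la_n; rewrite /isoproj /alg_act act_sum.
rewrite [RHS](reindex_inj (conjg_inj s)); apply: eq_bigr => g _.
rewrite actZ !actM -conjgC !ffunE; congr (_ * _ *: _).
by rewrite conjgE specht_charC // mulgK.
Qed.

Lemma isoproj_R2R n la (v : wspace F N n) :
  is_partition n la -> isoproj la (R2R v) = R2R (isoproj la v).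
Proof.
move=> la_n; rewrite {1}/R2R /alg_act linear_sum; apply: eq_bigr => g _.
by rewrite linearZ /= isoproj_act.
Qed.

(** The left side is the trace of [g] composed with the transposition sum, which is scalar on the
    module. *)
Lemma specht_char_sum_tperm n la (g : 'S_n) :
  is_partition n la ->
  \sum_p \sum_q specht_char F N la (g * tperm p q)%g
  = content_sum F N la * specht_char F N la g.
Proof.
move=> la_n; rewrite /specht_char /=; set b := vbasis _.
under eq_bigr do rewrite exchange_big.
rewrite exchange_big mulr_sumr; apply: eq_bigr => i _ /=.
have bi : b`_i \in specht F N n la.
  by apply/vbasis_mem/mem_nth; rewrite size_tuple.
have := sum_tperm_highest_weight (highest_weight_specht charF0 la_n bi).
move/(congr1 (fun v => coord b i (act v g))).
rewrite actZ linearZ /= => <-; rewrite act_sum linear_sum.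
apply: eq_bigr => p _; rewrite act_sum linear_sum.
by apply: eq_bigr => q _; rewrite actM.
Qed.

(** Reindexing g as [g * tperm p q] moves the transpositions from the vector to the character. *)
Lemma isoproj_sum_tperm n la (v : wspace F N n) :
  is_partition n la ->
  isoproj la (sum_tperm v) = content_sum F N la *: isoproj la v.
Proof.
move=> la_n; rewrite /sum_tperm linear_sum /=.
have isoproj_tperm p q : isoproj la (act v (tperm p q))
    = \sum_g ((\dim (specht F N n la))%:R / (n`!)%:R
        * specht_char F N la (g * tperm p q)%g) *: act v g.
  rewrite /isoproj /alg_act (reindex_inj (mulIg (tperm p q))) /=.
  by apply: eq_bigr => g _; rewrite ffunE actM -mulgA tperm2 mulg1.
under eq_bigr => p _.
  rewrite linear_sum; under eq_bigr do rewrite /= isoproj_tperm.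
  rewrite exchange_big; over.
rewrite exchange_big scaler_sumr; apply: eq_bigr => g _ /=.
rewrite ffunE scalerA mulrCA -specht_char_sum_tperm // mulr_sumr scaler_suml.
by apply: eq_bigr => p _; rewrite mulr_sumr scaler_suml.
Qed.

End SpechtModule.

(** * The added cell and the eigenvalue *)

Lemma content_sum_incr_nth (F : fieldType) N la (r : 'I_N) :
  content_sum F N (incr_nth la r)
  = content_sum F N la + (2%:R * ((nth 0%N la r)%:R - r%:R) + 1).
Proof.
rewrite /content_sum (bigD1 r) // [in RHS](bigD1 r) //= nth_incr_nth eqxx add1n.
rewrite (eq_bigr (fun b : 'I_N =>
  (nth 0%N la b)%:R ^+ 2 - 2%:R * b%:R * (nth 0%N la b)%:R)) => [|b ne].
  by rewrite -natr1; ring.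
by rewrite nth_incr_nth eq_sym (inj_eq val_inj) (negPf ne).
Qed.

Theorem theorem49 (F : fieldType) (charF0 : [pchar F] =i pred0)
    (N n : nat) (la mu : seq nat) (a : 'I_N) (r : nat)
    (la_n : is_partition n la) (ltlN : (size la < N)%N)
    (le_a_l : (a <= size la)%N) (le_r_a : (r <= a)%N)
    (def_mu : mu = incr_nth la r) (mu_n1 : is_partition n.+1 mu) :
  (forall v : wspace F N n, v \in specht F N n la ->
     R2R (projlift mu a v) - projlift mu a (R2R v)
     = (n.+1%:R + (nth 0%N la r).+1%:R - r.+1%:R) *: projlift mu a v)
  /\
  (forall (v : wspace F N n) (eps : F), v \in specht F N n la ->
     eigenvector (@R2R F N n) eps v ->
     projlift mu a v = 0 \/
     eigenvector (@R2R F N n.+1)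
       (eps + n.+1%:R + (nth 0%N la r).+1%:R - r.+1%:R) (projlift mu a v)).
Proof.
have ltrN : (r < N)%N by apply: leq_ltn_trans le_r_a (ltn_ord a).
have main (v : wspace F N n) : v \in specht F N n la ->
    R2R (projlift mu a v) - projlift mu a (R2R v)
    = (n.+1%:R + (nth 0%N la r).+1%:R - r.+1%:R) *: projlift mu a v.
  move=> v_la; rewrite /projlift -isoproj_R2R // -linearB.
  (* After projection, the transposition sums become the scalars of [mu] and [la], which differ by 2
     (la_r - r) + 1. The term [- sh a v] removes the 1, and halving leaves the content la_r - r, to
     which [n.+1] is added. *)
  have := congr1 (isoproj mu) (R2R_sh a v).
  rewrite (sum_tperm_highest_weight (highest_weight_specht charF0 la_n v_la)).
  rewrite -scaler_nat linearZ !linearB /= isoproj_sum_tperm // !linearZ.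
  rewrite def_mu (content_sum_incr_nth F la (Ordinal ltrN)) -def_mu /=.
  rewrite raddfMn; set D := isoproj mu (R2R _) - _.
  set x := isoproj mu (sh a v) => D2.
  have two_neq0 : 2%:R != 0 :> F by rewrite natf_eq0.
  apply: (scalerI two_neq0); rewrite -[D](subrK (x *+ n.+1)) scalerDr D2.
  rewrite -[x *+ _]scaler_nat !scalerA scalerN -scaleNr -[- x]scaleN1r.
  by rewrite -!scalerDl; congr (_ *: x); rewrite -!natr1; ring.
split=> // v eps v_la [_ Rv]; have [p0|p_neq0] := eqVneq (projlift mu a v) 0.
  by left.
right; split=> //; have /eqP := main v v_la.
have -> : projlift mu a (R2R v) = eps *: projlift mu a v.
  by rewrite Rv /projlift !linearZ.
rewrite subr_eq -scalerDl.
by move/eqP->; congr (_ *: _); ring.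
Qed.
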